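(* For every path-bipartite graph $G$ of sets $A$ and $B$, there is a metric $d$ on $X:=V(G)$ such that $G$ is path-proximinal for $A$ and $B$ with respect to the metric $d$.
   Context: Graphs are simple (no loops, no multiple edges), have a nonempty vertex set $V(G)$ and edge set $E(G)$, and may be infinite. A path is a finite graph $P$ whose (distinct) vertices can be numbered $u_0,\dots,u_k$, $k\ge 1$, so that $E(P)=\{\{u_0,u_1\},\dots,\{u_{k-1},u_k\}\}$. Let $A,B$ be nonempty disjoint sets. A path $P$ is a be-path of $A$ and $B$ if $V(P)\subseteq A\cup B$ and there is exactly one edge $\{a_0,b_0\}\in E(P)$ meeting both $A$ and $B$. A graph $G$ is a path-bipartite graph of $A$ and $B$ if $A,B\subseteq V(G)$ and $G$ is the union (of vertex sets and of edge sets) of a nonempty set of be-paths of $A$ and $B$. For a metric space $(X,d)$, a nonempty subset $A\subseteq X$ is proximinal if for every $x\in X$ there is $a_0\in A$ with $d(x,a_0)=\inf\{d(x,a)\colon a\in A\}$, and $\operatorname{dist}(A,B):=\inf\{d(a,b)\colon a\in A,\ b\in B\}$ for nonempty $A,B\subseteq X$. A path-bipartite graph $G$ of $A$ and $B$, with $X=A\cup B=V(G)$, is path-proximinal for $A$ and $B$ with respect to $d$ if $A$ and $B$ are proximinal subsets of $(X,d)$ and, for all distinct $x,y\in X$, $\{x,y\}\in E(G)\Leftrightarrow d(x,y)\le\operatorname{dist}(A,B)$. *)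

(* Defs.v *)
From HB Require Import structures.
From mathcomp Require Import all_boot all_order all_algebra.
From mathcomp Require Import all_classical all_reals.
From mathcomp Require Import metric_structure.

Set Implicit Arguments.
Unset Strict Implicit.
Unset Printing Implicit Defensive.

Import Order.TTheory GRing.Theory Num.Theory.

Local Open Scope classical_set_scope.
Local Open Scope ring_scope.

(* Vertex sets are sets in an ambient type T, so that a graph and the paths it
   is a union of live in the same type.  An edge is a two-element set. *)
Record sgraph (T : Type) := SGraph {
  vertices : set T;
  edges : set (set T);
  vertices_nonempty : vertices !=set0;
  edgesP : forall e, edges e ->
    exists x y, [/\ vertices x, vertices y, x <> y & e = [set x; y]]
}.

Definition is_path (T : Type) (P : sgraph T) : Prop :=
  exists (k : nat) (u : nat -> T),
    [/\ (1 <= k)%N,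
        set_inj `I_k.+1 u,
        vertices P = [set u i | i in `I_k.+1] &
        edges P = [set [set u i; u i.+1] | i in `I_k]].

Definition be_path (T : Type) (A B : set T) (P : sgraph T) : Prop :=
  [/\ is_path P,
      vertices P `<=` A `|` B &
      exists! e, [/\ edges P e, e `&` A !=set0 & e `&` B !=set0]].

Definition path_bipartite (T : Type) (A B : set T) (G : sgraph T) : Prop :=
  [/\ A !=set0, B !=set0 & A `&` B = set0] /\
  [/\ A `<=` vertices G, B `<=` vertices G &
      exists F : set (sgraph T),
        [/\ F !=set0,
            F `<=` be_path A B,
            vertices G = \bigcup_(P in F) vertices P &
            edges G = \bigcup_(P in F) edges P]].

(* Only the values of d on X matter. *)
Record metric_on (R : realType) (T : Type) (X : set T) (d : T -> T -> R) :
    Prop := MetricOn {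
  metric_on_ge0 : forall x y, X x -> X y -> 0 <= d x y;
  metric_on_eq0 : forall x y, X x -> X y -> (d x y = 0 <-> x = y);
  metric_on_sym : forall x y, X x -> X y -> d x y = d y x;
  metric_on_triangle :
    forall x y z, X x -> X y -> X z -> d x z <= d x y + d y z
}.

Lemma mdist_metric_on (R : realType) (M : metricType R) (X : set M) :
  metric_on X (@mdist R M).
Proof.
split=> [x y _ _|x y _ _|x y _ _|x y z _ _ _].
- exact: mdist_ge0.
- by split=> [|->]; [exact: mdist_positivity | exact: mdistxx].
- exact: metric_sym.
- exact: metric_triangle.
Qed.

(* In [proximinal] and [set_dist] the infimum is that of a nonempty set of
   nonnegative reals whenever d is a metric on a set containing A and B, so the
   default value 0 of [inf] plays no role. *)
Definition proximinal (R : realType) (T : Type) (X : set T) (d : T -> T -> R)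
    (A : set T) : Prop :=
  [/\ A !=set0,
      A `<=` X &
      forall x, X x -> exists2 a0, A a0 & d x a0 = inf [set d x a | a in A]].

Definition set_dist (R : realType) (T : Type) (d : T -> T -> R)
    (A B : set T) : R :=
  inf [set d a b | a in A & b in B].

Definition path_proximinal (R : realType) (T : Type) (d : T -> T -> R)
    (A B : set T) (G : sgraph T) : Prop :=
  [/\ path_bipartite A B G,
      proximinal (vertices G) d A,
      proximinal (vertices G) d B &
      forall x y, vertices G x -> vertices G y -> x <> y ->
        (edges G [set x; y] <-> d x y <= set_dist d A B)].

(* Main.v *)
(* Take the graph metric truncated at 2: distance 1 between adjacent vertices
   and 2 between distinct non-adjacent ones.  The triangle inequality holds since
   2 <= 1 + 1, infima of integer distances are attained, and
   dist(A, B) = 1 because every be-path has an edge joining A to B. *)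
Require Import Defs.
From HB Require Import structures.
From mathcomp Require Import all_boot all_order all_algebra.
From mathcomp Require Import all_classical all_reals.

Set Implicit Arguments.
Unset Strict Implicit.
Unset Printing Implicit Defensive.

Import Order.TTheory GRing.Theory Num.Theory.

Local Open Scope classical_set_scope.
Local Open Scope ring_scope.

(** The element [m] shows that [S] is both nonempty and bounded below, so [inf S] is a genuine
    infimum and not the default value 0. *)
Lemma inf_eq_min (R : realType) (S : set R) (m : R) :
  S m -> lbound S m -> inf S = m.
Proof.
move=> Sm lbm; apply/le_anti/andP; split.
  by apply: ge_inf => //; exists m.
by apply: lb_le_inf => //; exists m.
Qed.

(** Well-ordering of the naturals gives a least value of [f] on [A], and the cast to [R] preserves
    order. This yields proximinality of every nonempty subset. *)
Lemma inf_natr_attained (R : realType) (T : Type) (A : set T) (f : T -> nat) :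
  A !=set0 -> exists2 a, A a & (f a)%:R = inf [set ((f x)%:R : R) | x in A].
Proof.
move=> [a0 Aa0].
have exA : exists n, `[< (f @` A) n >] by exists (f a0); apply/asboolP; exists a0.
case: (ex_minnP exA) => _ /asboolP[a Aa <-] amin.
exists a => //; apply/esym/inf_eq_min; first by exists a.
by move=> _ [b Ab <-]; rewrite ler_nat; apply/amin/asboolP; exists b.
Qed.

Definition truncated_dist (T : Type) (G : sgraph T) (x y : T) : nat :=
  if `[< x = y >] then 0%N
  else if `[< edges G [set x; y] >] then 1%N else 2%N.

Section TruncatedDist.
Variables (T : Type) (G : sgraph T).

Lemma truncated_dist_eq0 (x y : T) : truncated_dist G x y = 0%N <-> x = y.
Proof. by rewrite /truncated_dist; case: asboolP => [//|?]; case: ifP. Qed.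

Lemma truncated_dist_le2 (x y : T) : (truncated_dist G x y <= 2)%N.
Proof. by rewrite /truncated_dist; case: ifP => // _; case: ifP. Qed.

Lemma truncated_dist_gt0 (x y : T) : x <> y -> (0 < truncated_dist G x y)%N.
Proof. by rewrite lt0n => xy; apply/eqP => /truncated_dist_eq0. Qed.

Lemma truncated_dist_sym (x y : T) : truncated_dist G x y = truncated_dist G y x.
Proof.
by rewrite /truncated_dist setUC (_ : (x = y) = (y = x))//; apply/propext; split.
Qed.

Lemma truncated_dist_triangle (x y z : T) :
  (truncated_dist G x z <= truncated_dist G x y + truncated_dist G y z)%N.
Proof.
have [<-|xy] := pselect (x = y); first exact: leq_addl.
have [<-|yz] := pselect (y = z); first exact: leq_addr.
apply: leq_trans (truncated_dist_le2 x z) _.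
by rewrite (leq_add (truncated_dist_gt0 xy) (truncated_dist_gt0 yz)).
Qed.

(** Off the diagonal only the values 1 and 2 occur, so the threshold 1 separates edges from
    non-edges. *)
Lemma truncated_dist_le1 (x y : T) :
  x <> y -> (truncated_dist G x y <= 1)%N <-> edges G [set x; y].
Proof.
by move=> xy; rewrite /truncated_dist asboolF//; case: asboolP.
Qed.

Lemma truncated_dist_metric_on (R : realType) (X : set T) :
  metric_on X (fun x y => (truncated_dist G x y)%:R : R).
Proof.
split=> [x y _ _|x y _ _|x y _ _|x y z _ _ _].
- exact: ler0n.
- rewrite -truncated_dist_eq0; split=> [/eqP|->//].
  by rewrite pnatr_eq0 => /eqP.
- by rewrite truncated_dist_sym.
- by rewrite -natrD ler_nat truncated_dist_triangle.
Qed.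

Lemma truncated_dist_proximinal (R : realType) (X A : set T) :
  A !=set0 -> A `<=` X ->
  proximinal X (fun x y => (truncated_dist G x y)%:R : R) A.
Proof. by move=> A0 AX; split=> // x _; exact: inf_natr_attained. Qed.

End TruncatedDist.

Lemma disjoint_neq (T : Type) (A B : set T) (a b : T) :
  A `&` B = set0 -> A a -> B b -> a <> b.
Proof.
move=> AB0 Aa Bb ab.
by have : (A `&` B) a by [split; rewrite // ab]; rewrite AB0.
Qed.

(** Any member of the nonempty family of be-paths has an edge meeting both sides. By disjointness
    its points in [A] and in [B] differ, so they exhaust this two-element set. *)
Lemma path_bipartite_cross_edge (T : Type) (A B : set T) (G : sgraph T) :
  path_bipartite A B G -> exists a b, [/\ A a, B b & edges G [set a; b]].
Proof.
move=> [[_ _ AB0] [_ _ [F [[P FP] Fbe _ GE]]]].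
have [_ _ [e [[Pe [a [ea Aa]] [b [eb Bb]]] _]]] := Fbe _ FP.
exists a, b; split=> //; rewrite GE; exists P => //.
have ab := disjoint_neq AB0 Aa Bb.
have [x [y [_ _ _ eE]]] := edgesP Pe.
suff <- : e = [set a; b] by [].
(* Each of [a], [b] is [x] or [y]; the two cases with [a = b] contradict [ab], and the other two
   agree up to order. *)
by move: ea eb; rewrite eE => -[] ax -[] yb; move: ab; rewrite ax yb // setUC.
Qed.

Theorem theorem3p3 (R : realType) (T : Type) (A B : set T) (G : sgraph T)
    (hG : path_bipartite A B G) :
  exists d : T -> T -> R,
    metric_on (vertices G) d /\ path_proximinal d A B G.
Proof.
have [[A0 B0 AB0] [AG BG _]] := hG.
exists (fun x y => (truncated_dist G x y)%:R).
split; first exact: truncated_dist_metric_on.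
split; [by []|exact: truncated_dist_proximinal..|].
have -> : set_dist (fun x y => (truncated_dist G x y)%:R : R) A B = 1.
  have [a [b [Aa Bb Eab]]] := path_bipartite_cross_edge hG.
  have ab := disjoint_neq AB0 Aa Bb.
  apply: inf_eq_min.
    (* The real 1 is read as [1%:R], which moves the equation to [nat]: the edge gives the upper
       bound, [a <> b] the lower one. *)
    exists a => //; exists b => //; apply/eqP; rewrite (eqr_nat _ _ 1) eqn_leq.
    by rewrite truncated_dist_gt0// andbT; apply/truncated_dist_le1.
  move=> _ [a' Aa' [b' Bb' <-]].
  by rewrite (ler_nat _ 1) truncated_dist_gt0//; exact: disjoint_neq AB0 Aa' Bb'.
by move=> x y _ _ xy; rewrite (ler_nat _ _ 1) truncated_dist_le1.
Qed.
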